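(* Let $Y$ be a topological vector space, let $A$ be a closed proper subset of $Y$, and let $k\in -0^+A\setminus\{0\}$. Let $B\subseteq Y$. Then: (a) If $A-B\subseteq A$, then $\varphi_{A,k}$ is $B$-monotone. (b) If $A-B\subseteq\mathbb{R}k+A$, then: $\varphi_{A,k}$ is $B$-monotone $\iff A-B\subseteq A$. (c) If $\varphi_{A,k}$ is finite-valued on $F\subseteq Y$, then: $A-(B\setminus\{0\})\subseteq\operatorname{core}A$ implies that $\varphi_{A,k}$ is strictly $B$-monotone on $F$. (d) If $A-\mathbb{R}_{>}k\subseteq\operatorname{core}A$ and $A-B\subseteq\mathbb{R}k+A$, then: $\varphi_{A,k}$ strictly $B$-monotone implies $A-(B\setminus\{0\})\subseteq\operatorname{core}A$. (e) If $A-\mathbb{R}_{>}k\subseteq\operatorname{int}A$ and $A-B\subseteq\mathbb{R}k+A$, then: $\varphi_{A,k}$ strictly $B$-monotone implies $A-(B\setminus\{0\})\subseteq\operatorname{int}A$. (f) If $\varphi_{A,k}$ is proper and $A-\operatorname{int}B\subseteq\mathbb{R}k+A$, then: $\varphi_{A,k}$ is strictly $(\operatorname{int}B)$-monotone $\iff$ $\varphi_{A,k}$ is $(\operatorname{int}B)$-monotone. If additionally $B\subseteq\operatorname{cl}\operatorname{int}B$, then: $\varphi_{A,k}$ is strictly $(\operatorname{int}B)$-monotone $\iff$ $\varphi_{A,k}$ is $B$-monotone.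
   Context: Vector spaces are real; $\mathbb{R}_+=\{t\in\mathbb{R}\mid t\ge0\}$, $\mathbb{R}_{>}=\{t\in\mathbb{R}\mid t>0\}$. ''Proper subset of $Y$'' means nonempty and different from $Y$. $\operatorname{core}$ is the algebraic interior; $\operatorname{int}$, $\operatorname{cl}$ the topological interior and closure. $0^+A=\{u\in Y\mid a+tu\in A\ \forall a\in A,\ \forall t\in\mathbb{R}_+\}$ is the recession cone. $\nu$ is a symbolic value not in $\overline{\mathbb{R}}=\mathbb{R}\cup\{\pm\infty\}$, and $\inf\emptyset:=\nu$. The function $\varphi_{A,k}:Y\to\overline{\mathbb{R}}\cup\{\nu\}$ is $\varphi_{A,k}(y)=\inf\{t\in\mathbb{R}\mid y\in tk+A\}$; $\operatorname{dom}\varphi_{A,k}=\{y\in Y\mid\varphi_{A,k}(y)\in\mathbb{R}\cup\{-\infty\}\}$. It is proper if $\operatorname{dom}\varphi_{A,k}\neq\emptyset$ and it is real-valued on $\operatorname{dom}\varphi_{A,k}$; it is finite-valued on $F$ if $\varphi_{A,k}(y)\in\mathbb{R}$ for all $y\in F$. For $\varphi:Y\to\overline{\mathbb{R}}\cup\{\nu\}$, $B\subseteq Y$ and $F\subseteq\operatorname{dom}\varphi$: $\varphi$ is $B$-monotone on $F$ if $y^1,y^2\in F$ and $y^2-y^1\in B$ imply $\varphi(y^1)\le\varphi(y^2)$; strictly $B$-monotone on $F$ if $y^1,y^2\in F$ and $y^2-y^1\in B\setminus\{0\}$ imply $\varphi(y^1)<\varphi(y^2)$. ''$B$-monotone'' and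 ''strictly $B$-monotone'' without reference to $F$ mean on $F=\operatorname{dom}\varphi$. *)

(* Defs.v *)
From mathcomp Require Import all_boot all_order all_algebra.
From mathcomp Require Import all_classical all_reals.
From mathcomp Require Import ereal topology normedtype.

Set Implicit Arguments.
Unset Strict Implicit.
Unset Printing Implicit Defensive.

Import Order.TTheory GRing.Theory Num.Theory.
Import numFieldNormedType.Exports.

Local Open Scope classical_set_scope.
Local Open Scope ring_scope.

Section LinearSpace.
Context (R : realType) (Y : lmodType R).
Implicit Types (A B : set Y) (k : Y).

Definition msum A B : set Y := [set a + b | a in A & b in B].

Definition mdiff A B : set Y := [set a - b | a in A & b in B].

Definition mopp A : set Y := [set - a | a in A].

Definition multiples (T : set R) k : set Y := [set t *: k | t in T].

Definition proper_subset A : Prop := A !=set0 /\ A <> setT.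

Definition core A : set Y :=
  [set a | A a /\ forall y : Y, exists2 t : R, 0 < t &
             forall s : R, 0 <= s <= t -> A (a + s *: y)].

Definition recession_cone A : set Y :=
  [set u | forall (a : Y) (t : R), A a -> 0 <= t -> A (a + t *: u)].

End LinearSpace.

(* Values in [-oo, +oo] together with the symbolic value nu, encoded as None. *)
Definition nureal (R : realType) : Type := option (\bar R).

(* nu is not comparable with any value, not even with itself. *)
Definition nu_le (R : realType) (x y : nureal R) : Prop :=
  match x, y with
  | Some u, Some v => (u <= v)%E
  | _, _ => False
  end.

Definition nu_lt (R : realType) (x y : nureal R) : Prop :=
  match x, y with
  | Some u, Some v => (u < v)%E
  | _, _ => False
  end.

(* The infimum of a set of reals, with inf set0 = nu instead of +oo. *)
Definition nu_inf (R : realType) (T : set R) : nureal R :=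
  if T == set0 then None else Some (ereal_inf [set t%:E | t in T]).

Section Functions.
Context (R : realType) (Y : lmodType R).
Implicit Types (A B F : set Y) (k : Y) (phi : Y -> nureal R).

Definition gerstewitz A k : Y -> nureal R :=
  fun y => nu_inf [set t : R | msum [set t *: k] A y].

Definition eff_dom phi : set Y :=
  [set y | (exists r : R, phi y = Some r%:E) \/ phi y = Some -oo%E].

Definition finite_valued_on phi F : Prop :=
  forall y : Y, F y -> exists r : R, phi y = Some r%:E.

Definition nu_proper phi : Prop := eff_dom phi !=set0 /\ finite_valued_on phi (eff_dom phi).

Definition B_monotone_on B phi F : Prop :=
  forall y1 y2 : Y, F y1 -> F y2 -> B (y2 - y1) -> nu_le (phi y1) (phi y2).

Definition strictly_B_monotone_on B phi F : Prop :=
  forall y1 y2 : Y, F y1 -> F y2 -> (B `\ 0) (y2 - y1) ->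
    nu_lt (phi y1) (phi y2).

Definition B_monotone B phi : Prop := B_monotone_on B phi (eff_dom phi).

Definition strictly_B_monotone B phi : Prop := strictly_B_monotone_on B phi (eff_dom phi).

End Functions.

(* Main.v *)
Require Import Defs.
From mathcomp Require Import all_boot all_order all_algebra.
From mathcomp Require Import all_classical all_reals.
From mathcomp Require Import ereal topology normedtype.

Set Implicit Arguments.
Unset Strict Implicit.
Unset Printing Implicit Defensive.

Import Order.TTheory GRing.Theory Num.Theory.
Import numFieldNormedType.Exports.

Local Open Scope classical_set_scope.
Local Open Scope ring_scope.

(** Everything rests on reading [phi = gerstewitz A k] through its sublevel
    sets.  The condition on [k] says that the set of [t] with [A (y - t *: k)]
    is upward closed, so [phi y < t] already gives [A (y - t *: k)]
    ([gerstewitz_lt_mem]); closedness of [A] makes a finite infimum attained,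
    hence [phi y <= t <-> A (y - t *: k)] for every real [t] ([gerstewitz_leP]).
    In particular [phi <= 0] on [A], and the effective domain is the union of
    the translates of [A] along the line of [k].

    Monotonicity and inclusions then translate into each other.  If
    [y2 - y1] lies in [B] and [y2 - t *: k] in [A], then
    [y1 - t *: k = (y2 - t *: k) - (y2 - y1)] lies in [A - B]; so
    [A - B `<=` A] gives [B]-monotonicity, and if [A - (B \ 0)] lies in the
    core and [phi] is finite, there is room to move a little further along [k],
    which makes the inequality strict.  Conversely, for [a] in [A] and [b] in [B] the
    assumption [A - B `<=` R k + A] puts [a - b] in the effective domain, so
    monotonicity applies to the pair [a - b], [a]: it yields
    [phi (a - b) <= phi a <= 0], hence [A (a - b)].  A strict inequality yields
    [phi (a - b) < 0], which puts [a - b] in [A - t *: k] for some [t > 0]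
    and so in whatever set contains all these translates: the core and the
    interior are two instances of [strictly_monotone_mdiff].

    For an open [B], moving from [y1] to [y1 + s *: k] with small [s > 0] keeps
    the difference to [y2] in [B] and raises [phi] by [s]; when [phi] is finite
    this turns monotonicity into strict monotonicity.  The passage from the
    interior of [B] to [B] is the stability of [A - B `<=` A] under closure of
    [B] ([mdiff_closure]). *)

Lemma line_continuous (R : realType) (Y : topologicalLmodType R) (y k : Y) :
  continuous (fun t : R => y - t *: k).
Proof.
move=> t; apply: (@continuous_comp _ _ _ (fun s : R => (y, s *: k))
  (fun z : Y * Y => z.1 - z.2)); last exact: sub_continuous.
apply: cvg_pair; first exact: cvg_cst.
apply: (@continuous_comp _ (R^o * Y)%type _ (fun s : R => (s, k))
  (fun z : R^o * Y => z.1 *: z.2)); last exact: scale_continuous.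
(* The filter on the product must be the one of [R^o], the carrier for which
   scaling is stated to be continuous. *)
apply: (@cvg_pair _ _ _ _ (nbhs (t : R^o)) (nbhs k)); first exact: cvg_id.
exact: cvg_cst.
Qed.

(** What makes a finite value of [gerstewitz A k] an attained infimum: the
    parameters [t] with [y - t *: k] in a closed set form a closed set of
    reals. *)
Lemma closed_line_right (R : realType) (Y : topologicalLmodType R) (A : set Y)
    (y k : Y) (t : R) :
  closed A -> (forall s, t < s -> A (y - s *: k)) -> A (y - t *: k).
Proof.
move=> Acl At; have cvgt : y - s *: k @[s --> t^'+] --> y - t *: k.
  by apply: cvg_at_right_filter; exact: line_continuous.
apply: (closed_cvg A Acl _ (y - t *: k) cvgt).
by near=> s; apply: At; near: s; exact: nbhs_right_gt.
Unshelve. all: by end_near. Qed.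

(** A point of an open set can be pushed slightly against [k]; this is the room
    that upgrades monotonicity to strict monotonicity. *)
Lemma open_line_right (R : realType) (Y : topologicalLmodType R) (U : set Y)
    (y k : Y) :
  open U -> U y -> exists2 s : R, 0 < s & U (y - s *: k).
Proof.
move=> Uo Uy; have : \forall s \near (0 : R)^'+, U (y - s *: k).
  have cvg0 : y - s *: k @[s --> (0 : R)^'+] --> y - 0 *: k.
    by apply: cvg_at_right_filter; exact: line_continuous.
  by apply: cvg0; rewrite scale0r subr0; exact: open_nbhs_nbhs.
move=> nearU; near (0 : R)^'+ => s; exists s.
  by near: s; exact: nbhs_right_gt.
by near: s.
Unshelve. all: by end_near. Qed.

(** For fixed [a], the map [b |-> a - b] is continuous, so it sends limits of
    points of [B] to limits of points of the closed set [A]. *)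
Lemma mdiff_closure (R : realType) (Y : topologicalLmodType R) (A B : set Y) :
  closed A -> mdiff A B `<=` A -> mdiff A (closure B) `<=` A.
Proof.
move=> Acl ABA _ [a Aa [b Bb <-]]; apply: Acl => U Uab.
have ac : {for b, continuous (fun x => a - x)}.
  apply: (@continuous_comp _ _ _ (fun x : Y => (a, x))
    (fun z : Y * Y => z.1 - z.2)); last exact: sub_continuous.
  by apply: cvg_pair; [exact: cvg_cst|exact: cvg_id].
have [c [Bc Uc]] := Bb _ (ac _ Uab).
by exists (a - c); split => //; apply: ABA; exists a => //; exists c.
Qed.

Lemma nu_le_trans (R : realType) (y x z : nureal R) :
  nu_le x y -> nu_le y z -> nu_le x z.
Proof. by case: x y z => [x|] [y|] [z|] //=; exact: le_trans. Qed.

Lemma nu_lt_le_trans (R : realType) (y x z : nureal R) :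
  nu_lt x y -> nu_le y z -> nu_lt x z.
Proof. by case: x y z => [x|] [y|] [z|] //=; exact: lt_le_trans. Qed.

Lemma nu_ltW (R : realType) (x y : nureal R) : nu_lt x y -> nu_le x y.
Proof. by case: x y => [x|] [y|] //=; exact: ltW. Qed.

Section Gerstewitz.
Context (R : realType) (Y : lmodType R) (A : set Y) (k : Y).
Implicit Types (y : Y) (s t : R) (B : set Y).
Local Notation phi := (gerstewitz A k).

Lemma msum_lineE y t : msum [set t *: k] A y <-> A (y - t *: k).
Proof.
split=> [[_ -> [a Aa <-]]|Ay]; first by rewrite addrC addKr.
by exists (t *: k) => //; exists (y - t *: k) => //; rewrite addrC subrK.
Qed.

Lemma gerstewitzE y t : A (y - t *: k) ->
  phi y = Some (ereal_inf [set t%:E | t in [set t | A (y - t *: k)]]).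
Proof.
move=> Ay; rewrite /gerstewitz /nu_inf.
have -> : [set t | msum [set t *: k] A y] = [set t | A (y - t *: k)].
  by apply/seteqP; split=> s /msum_lineE.
by case: eqP => // E; have : set0 t by rewrite -E.
Qed.

Lemma gerstewitz_Some y u : phi y = Some u -> exists t, A (y - t *: k).
Proof.
rewrite /gerstewitz /nu_inf; case: eqP => // /eqP/set0P[t /msum_lineE At] _.
by exists t.
Qed.

Lemma gerstewitz_ub y t : A (y - t *: k) -> nu_le (phi y) (Some t%:E).
Proof.
move=> Ay; rewrite (gerstewitzE Ay) /=; apply: ereal_inf_lbound.
by exists t.
Qed.

Lemma eff_domP y : eff_dom phi y <-> exists t, A (y - t *: k).
Proof.
split=> [[[r]|]|[t Ay]]; [exact: gerstewitz_Some|exact: gerstewitz_Some|].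
have := gerstewitz_ub Ay; rewrite /eff_dom /= (gerstewitzE Ay) /=.
by case: ereal_inf => [r| |] //= _; [left; exists r|right].
Qed.

Lemma eff_dom_multiples y : msum (multiples setT k) A y -> eff_dom phi y.
Proof.
move=> [_ [t _ <-] [a Aa <-]]; apply/eff_domP; exists t.
by rewrite addrC addKr.
Qed.

Lemma sub_eff_dom y : A y -> eff_dom phi y.
Proof. by move=> Ay; apply/eff_domP; exists 0; rewrite scale0r subr0. Qed.

(** Comparing values amounts to comparing the sets of admissible parameters.
    The domain condition on [y2] is needed because the symbolic value is not
    comparable even with itself. *)
Lemma gerstewitz_homo y1 y2 : eff_dom phi y2 ->
  (forall t, A (y2 - t *: k) -> A (y1 - t *: k)) -> nu_le (phi y1) (phi y2).
Proof.
move=> /eff_domP[t A2] A21; rewrite (gerstewitzE A2) (gerstewitzE (A21 _ A2)).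
rewrite /=; apply: le_ereal_inf_tmp => _ [s /= /A21 As <-].
by apply: ereal_inf_lbound; exists s.
Qed.

Lemma gerstewitz_lt y t :
  nu_lt (phi y) (Some t%:E) -> exists2 s, s < t & A (y - s *: k).
Proof.
case E : (phi y) => [u|] //=; have [s As] := gerstewitz_Some E.
move: E; rewrite (gerstewitzE As) => -[<-] /ereal_inf_lt[_ [r /= Ar <-]].
by rewrite lte_fin => rt; exists r.
Qed.

(** Subtracting [y2 - y1], a member of [B], from [y2 - t *: k] gives
    [y1 - t *: k]: every parameter admissible for [y2] is admissible for
    [y1]. *)
Lemma mdiff_monotone B : mdiff A B `<=` A -> B_monotone B phi.
Proof.
move=> ABA y1 y2 _ d2 Bb; apply: gerstewitz_homo => // t A2; apply: ABA.
exists (y2 - t *: k) => //; exists (y2 - y1) => //.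
by rewrite opprB addrC addrA subrK.
Qed.

End Gerstewitz.

Section Recession.
Context (R : realType) (Y : lmodType R) (A : set Y) (k : Y).
Hypothesis Ak : mopp (recession_cone A) k.
Implicit Types (y : Y) (s t : R) (B F : set Y).
Local Notation phi := (gerstewitz A k).

Lemma recession_line y s t : s <= t -> A (y - s *: k) -> A (y - t *: k).
Proof.
case: Ak => u uA <- st As; have := uA _ (t - s) As; rewrite subr_ge0 => /(_ st).
by rewrite !scalerN !opprK -addrA -scalerDl [s + _]addrC subrK.
Qed.

Lemma gerstewitz_lt_mem y t : nu_lt (phi y) (Some t%:E) -> A (y - t *: k).
Proof. by move=> /gerstewitz_lt[s /ltW]; exact: recession_line. Qed.

(** A negative value at [y] comes from a negative parameter [s], that is, from
    a point of [A] from which [y] is reached by going [- s > 0] against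
    [k]. *)
Lemma lt0_gerstewitz_mem (K : set Y) y :
  mdiff A (multiples [set t | 0 < t] k) `<=` K ->
  nu_lt (phi y) (Some 0%:E) -> K y.
Proof.
move=> AK /gerstewitz_lt[s s0 As]; apply: AK.
exists (y - s *: k) => //.
exists (- s *: k); last by rewrite scaleNr opprK subrK.
by exists (- s) => //=; rewrite oppr_gt0.
Qed.

(** Strict monotonicity gives [phi (a - b) < phi a <= 0].  The set [K] is kept
    arbitrary because the core and the interior of [A] enter only by containing
    the translates of [A] against [k]. *)
Lemma strictly_monotone_mdiff (K : set Y) B :
  mdiff A (multiples [set t | 0 < t] k) `<=` K ->
  mdiff A B `<=` msum (multiples setT k) A ->
  strictly_B_monotone B phi -> mdiff A (B `\ 0) `<=` K.
Proof.
move=> AK ABd mono _ [a Aa [b [Bb b0] <-]]; apply: (lt0_gerstewitz_mem AK).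
have a0 : nu_le (phi a) (Some 0%:E).
  by apply: gerstewitz_ub; rewrite scale0r subr0.
apply: nu_lt_le_trans a0; apply: mono.
- by apply/eff_dom_multiples/ABd; exists a => //; exists b.
- exact: sub_eff_dom.
- by rewrite opprB addrC subrK.
Qed.

End Recession.

Section Closed.
Context (R : realType) (Y : topologicalLmodType R) (A : set Y) (k : Y).
Hypothesis Ak : mopp (recession_cone A) k.
Hypothesis Acl : closed A.
Implicit Types (y : Y) (s t : R) (B F : set Y).
Local Notation phi := (gerstewitz A k).

(** The sublevel set of [phi] at height [t] is the translate of [A] by
    [t *: k]: every [s > t] is admissible, and closedness lets [s] decrease
    to [t]. *)
Lemma gerstewitz_leP y t : nu_le (phi y) (Some t%:E) <-> A (y - t *: k).
Proof.
split=> [le_t|]; last exact: gerstewitz_ub.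
apply: closed_line_right => // s ts; apply: gerstewitz_lt_mem => //.
move: le_t; case: (phi y) => [u|] //= ut.
by apply: le_lt_trans ut _; rewrite lte_fin.
Qed.

(** For the direct implication, monotonicity is tested on the pair [a - b],
    [a], where [phi a <= 0]; the inclusion hypothesis serves to have [a - b] in
    the effective domain. *)
Lemma monotoneP B : mdiff A B `<=` msum (multiples setT k) A ->
  B_monotone B phi <-> mdiff A B `<=` A.
Proof.
move=> ABd; split=> [mono _ [a Aa [b Bb <-]]|]; last exact: mdiff_monotone.
have Aa0 : A (a - 0 *: k) by rewrite scale0r subr0.
rewrite -[a - b]subr0 -(scale0r k); apply/gerstewitz_leP.
apply: nu_le_trans (gerstewitz_ub Aa0); apply: mono.
- by apply/eff_dom_multiples/ABd; exists a => //; exists b.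
- exact: sub_eff_dom.
- by rewrite opprB addrC subrK.
Qed.

(** The finite infimum [r = phi y2] is attained, so [y1 - r *: k] lies in the
    core; moving from there by [s *: k] with a small [s > 0] stays in [A] and
    shows that the smaller parameter [r - s] is admissible for [y1]. *)
Lemma mdiff_core_strictly_monotone B F : finite_valued_on phi F ->
  mdiff A (B `\ 0) `<=` core A -> strictly_B_monotone_on B phi F.
Proof.
move=> finF ABc y1 y2 _ /finF[r phi2] Bb.
have A2 : A (y2 - r *: k) by apply/gerstewitz_leP; rewrite phi2 /=.
have [|_ /(_ k)[s s0 As]] := ABc (y1 - r *: k).
  exists (y2 - r *: k) => //; exists (y2 - y1) => //.
  by rewrite opprB addrC addrA subrK.
have {As} : A (y1 - (r - s) *: k).
  rewrite scalerBl opprB [s *: k - _]addrC addrA.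
  by apply: As; rewrite lexx ltW.
move=> /gerstewitz_ub; rewrite phi2; case: (phi y1) => [u|] //= us.
by apply: le_lt_trans us _; rewrite lte_fin gtrBl.
Qed.

(** Monotonicity is applied to [y1 + s *: k], whose difference to [y2] is still
    in the open set [B], and translating by [s *: k] raises the value by [s];
    this is a strict gain only because [phi y2] is finite.  In the other
    direction only equal points are left over, as strictness ignores [0]. *)
Lemma open_strictly_monotoneP B :
  finite_valued_on phi (eff_dom phi) -> open B ->
  strictly_B_monotone B phi <-> B_monotone B phi.
Proof.
move=> fin Bo; split=> mono y1 y2 d1 d2 Bb.
  have [->|y21] := eqVneq y1 y2.
    by have [r ->] := fin _ d2; rewrite /=.
  apply/nu_ltW/mono => //; split=> // /eqP.
  by rewrite subr_eq0 eq_sym (negbTE y21).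
case: Bb => Bb _; have [r phi2] := fin _ d2.
have [s s0 Bs] := open_line_right k Bo Bb.
have : nu_le (phi (y1 + s *: k)) (phi y2).
  apply: mono => //; last by rewrite opprD addrA.
  have /eff_domP[t At] := d1; apply/eff_domP; exists (t + s).
  by rewrite scalerDl opprD addrACA subrr addr0.
rewrite phi2 => /gerstewitz_leP As.
have /gerstewitz_ub : A (y1 - (r - s) *: k) by rewrite scalerBl opprB addrA.
case: (phi y1) => [u|] //= us.
by apply: le_lt_trans us _; rewrite lte_fin gtrBl.
Qed.

End Closed.

Theorem theorem3 (R : realType) (Y : topologicalLmodType R)
    (A : set Y) (Aclosed : closed A) (Aproper : proper_subset A)
    (k : Y) (hk : (mopp (recession_cone A) `\ 0) k) (B : set Y) :
  (* (a) *)
  (mdiff A B `<=` A -> B_monotone B (gerstewitz A k)) /\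
  (* (b) *)
  (mdiff A B `<=` msum (multiples setT k) A ->
    (B_monotone B (gerstewitz A k) <-> mdiff A B `<=` A)) /\
  (* (c) *)
  (forall F : set Y, finite_valued_on (gerstewitz A k) F ->
    mdiff A (B `\ 0) `<=` core A ->
    strictly_B_monotone_on B (gerstewitz A k) F) /\
  (* (d) *)
  (mdiff A (multiples [set t : R | 0 < t] k) `<=` core A ->
    mdiff A B `<=` msum (multiples setT k) A ->
    strictly_B_monotone B (gerstewitz A k) -> mdiff A (B `\ 0) `<=` core A) /\
  (* (e) *)
  (mdiff A (multiples [set t : R | 0 < t] k) `<=` interior A ->
    mdiff A B `<=` msum (multiples setT k) A ->
    strictly_B_monotone B (gerstewitz A k) -> mdiff A (B `\ 0) `<=` interior A) /\
  (* (f) *)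
  (nu_proper (gerstewitz A k) ->
    mdiff A (interior B) `<=` msum (multiples setT k) A ->
    (strictly_B_monotone (interior B) (gerstewitz A k) <->
      B_monotone (interior B) (gerstewitz A k)) /\
    (B `<=` closure (interior B) ->
      (strictly_B_monotone (interior B) (gerstewitz A k) <->
        B_monotone B (gerstewitz A k)))).
Proof.
have Ak : mopp (recession_cone A) k by case: hk.
split; first exact: mdiff_monotone.
split; first exact: monotoneP.
split; first by move=> F; exact: mdiff_core_strictly_monotone.
split; first exact: strictly_monotone_mdiff.
split; first exact: strictly_monotone_mdiff.
move=> [_ phi_fin] ABd.
have int_mono := open_strictly_monotoneP Ak Aclosed phi_fin
  (@open_interior _ B).
split=> // Bcl; split=> [/int_mono/(monotoneP Ak Aclosed ABd) AintB|mono].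
  apply: mdiff_monotone => _ [a Aa [b /Bcl Bb <-]].
  by apply: mdiff_closure AintB _ _ => //; exists a => //; exists b.
apply/int_mono => y1 y2 d1 d2 /interior_subset.
exact: mono.
Qed.
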